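(* Let $(A,H,D,J)$ be a real spectral triple, with representation $\pi$, which satisfies the order-one condition, and with fixed signs $\epsilon,\epsilon'$. Let $k\in\pi(A)$ be positive and invertible such that $k^{-1}$ is also bounded, and let $k':=JkJ^{-1}$. Define $$D_k:=k'Dk',\qquad \nu(h):=(k^{-1}k')(h)\quad (h\in H).$$ Then $(A,H,D_k)$ with $J$ and $\nu$ is a $\nu$-twisted real spectral triple. If furthermore $(A,H,D,J)$ is even with grading $\gamma$, then $(A,H,D_k,J,\nu)$ is even with the same grading $\gamma$.
   Context: **Spectral triple.** $A$ is a complex $*$-algebra, $H$ a Hilbert space, $\pi$ a $*$-representation of $A$ on $H$ by bounded operators, and $D$ an (essentially) selfadjoint operator on a dense domain $H_0\subseteq H$ with compact resolvent such that $[D,\pi(a)]$ is bounded for every $a\in A$. **Twist.** $\nu$ is an (essentially) selfadjoint invertible operator on $H$ whose domain contains $H_0$, and $\bar\nu(\phi):=\nu\circ\phi\circ\nu^{-1}$. It is required that $\bar\nu$ maps $\pi(A)$ into bounded operators; more precisely, for all $a\in A$, $\nu\pi(a)\nu^{-1}$ preserves $H_0$ and is bounded on $H_0$, so it extends to an element of $B(H)$. It is also required that there is an algebra automorphism $\hat\nu:A\to A$ with $\pi\circ\hat\nu=\bar\nu\circ\pi$. **$\nu$-twisted real spectral triple.** The spectral triple $(A,H,D)$ is a $\nu$-twisted real spectral triple (admits a $\nu$-twisted real structure $J$) if $J:H\to H$ is an antiunitary (anti-linear) map such that, for some signs $\epsilon,\epsilon'\in\{+,-\}$ and all $a,b\in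 A$: - $J^2=\epsilon\,\mathrm{id}$; - $[\pi(a),J\pi(b)J^{-1}]=0$ (order-zero condition); - $[D,\pi(a)]\,J\bar\nu^2(\pi(b))J^{-1}=J\pi(b)J^{-1}[D,\pi(a)]$ (twisted order-one condition); - $DJ\nu=\epsilon'\,\nu JD$ (twisted $\epsilon'$-condition); - $\nu J\nu=J$ (twisted regularity). The last two conditions are understood as identities of operators $H_0\to H_0$. **Even case.** The triple is even with grading $\gamma$ if $\gamma:H\to H$ is a selfadjoint operator with $\gamma^2=\mathrm{id}$, $[\gamma,\pi(a)]=0$ for all $a\in A$, $\gamma D=-D\gamma$, $\nu^2\gamma=\gamma\nu^2$, and $\gamma J=\epsilon''J\gamma$ for some sign $\epsilon''\in\{+,-\}$. **Real spectral triple.** A real spectral triple $(A,H,D,J)$ satisfying the order-one condition is a $\nu$-twisted real spectral triple with $\nu=\mathrm{id}$, that is, a spectral triple $(A,H,D)$ with an antiunitary map $J:H\to H$ such that $J^2=\epsilon\,\mathrm{id}$, $[\pi(a),J\pi(b)J^{-1}]=0$, $[[D,\pi(a)],J\pi(b)J^{-1}]=0$ for all $a,b\in A$, and $DJ=\epsilon'JD$; in the even case, with grading $\gamma$ (selfadjoint, $\gamma^2=\mathrm{id}$, $[\gamma,\pi(a)]=0$ for all $a\in A$, $\gamma D=-D\gamma$), also $\gamma J=\epsilon''J\gamma$.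
   Formalization: The algebra A is taken unital and k is required to be the image under π of an invertible element of A, not merely an element of π(A) with bounded inverse; otherwise k^{-1}π(a)k may leave π(A), so that the automorphism of A required by the twist need not exist. *)

(* Defs.v *)
From HB Require Import structures.
From mathcomp Require Import all_boot all_order all_algebra.
From mathcomp Require Import complex.
From mathcomp Require Import all_classical all_reals all_analysis.
Set Implicit Arguments.
Unset Strict Implicit.
Unset Printing Implicit Defensive.
Import Order.TTheory GRing.Theory Num.Theory.
Import numFieldNormedType.Exports.
Local Open Scope classical_set_scope.
Local Open Scope ring_scope.
Local Open Scope complex_scope.

(* Signs are booleans: e : bool stands for (-1) ^+ e.

   An operator with domain X is a function H -> H of which only the values on
   X : set H matter; pinv X f is its inverse, defined on f @` X. *)

Section Operators.
Variables (R : realType) (H : completeNormedModType R[i]).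
Variable dot : {dot H for Num.conj}.
Implicit Types (X Y : set H) (f T S : H -> H) (G : set (H * H)) (z : R[i]).

(* dot is linear in its first argument; together with the completeness of H
   this makes (H, dot) a Hilbert space. *)
Definition hilbert_norm := forall x : H, `|x| ^+ 2 = dot x x.

Definition subspace X :=
  X 0 /\ forall (c : R[i]) x y, X x -> X y -> X (c *: x + y).

Definition linear_on X f :=
  forall (c : R[i]) x y, X x -> X y -> f (c *: x + y) = c *: f x + f y.

Definition bounded_on X f :=
  exists M : R[i], forall h, X h -> `|f h| <= M * `|h|.

Definition bounded_op T := linear T /\ bounded_on setT T.

Definition extends X f T := bounded_op T /\ {in X, T =1 f}.

Definition antiunitary (J : H -> H) :=
  [/\ bijective J,
      forall (c : R[i]) x y, J (c *: x + y) = Num.conj c *: J x + J y &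
      forall x y, dot (J x) (J y) = dot y x].

Definition graph X f : set (H * H) := [set p | X p.1 /\ p.2 = f p.1].

Definition adjoint_graph G : set (H * H) :=
  [set p | forall q, G q -> dot q.2 p.1 = dot q.1 p.2].

Definition densely_defined X f := [/\ subspace X, dense X & linear_on X f].

Definition selfadjoint X f :=
  densely_defined X f /\ adjoint_graph (graph X f) = graph X f.

Definition ess_selfadjoint X f :=
  densely_defined X f /\
  adjoint_graph (closure (graph X f)) = closure (graph X f).

Definition compact_op T := precompact (T @` [set h | `|h| <= 1]).

(* S = (T - z)^-1, where T is the operator with graph G *)
Definition is_resolvent G z S :=
  [/\ bounded_op S,
      forall h, G (S h, h + z *: S h) &
      forall p, G p -> S (p.2 - z *: p.1) = p.1].

Definition compact_resolvent X f :=
  exists z S, is_resolvent (closure (graph X f)) z S /\ compact_op S.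

Definition commutator f T : H -> H := fun h => f (T h) - T (f h).

End Operators.

Section TwistedRealSpectralTriples.
Variables (R : realType) (A : algType R[i]) (star : A -> A).
Variables (H : completeNormedModType R[i]) (dot : {dot H for Num.conj}).
Variable pi : A -> H -> H.

Definition star_algebra :=
  [/\ forall (c : R[i]) a b, star (c *: a + b) = Num.conj c *: star a + star b,
      forall a b, star (a * b) = star b * star a &
      involutive star].

Record star_representation : Prop := StarRepresentation {
  srep_bounded : forall a, bounded_op (pi a);
  srep_linear : forall (c : R[i]) a b h, pi (c *: a + b) h = c *: pi a h + pi b h;
  srep_mul : forall a b h, pi (a * b) h = pi a (pi b h);
  srep_star : forall a x y, dot (pi a x) y = dot x (pi (star a) y) }.

Variables (H0 : set H) (D : H -> H).

Record spectral_triple : Prop := SpectralTriple {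
  st_hilbert : hilbert_norm dot;
  st_star : star_algebra;
  st_rep : star_representation;
  st_ess_selfadjoint : ess_selfadjoint dot H0 D;
  st_compact_resolvent : compact_resolvent H0 D;
  st_domain : forall a, set_fun H0 H0 (pi a);
  st_bounded_commutator : forall a, bounded_on H0 (commutator D (pi a)) }.

(* nu is an operator with domain V *)
Variables (V : set H) (nu : H -> H).

Definition nubar (phi : H -> H) : H -> H := nu \o phi \o pinv V nu.

Record twist : Prop := Twist {
  tw_ess_selfadjoint : ess_selfadjoint dot V nu;
  tw_invertible : set_bij V setT nu;
  tw_domain : H0 `<=` V;
  tw_defined : forall a h, H0 h -> V (pi a (pinv V nu h));
  tw_preserves : forall a, set_fun H0 H0 (nubar (pi a));
  tw_bounded : forall a, bounded_on H0 (nubar (pi a));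
  tw_automorphism : exists2 nuhat : {lrmorphism A -> A}, bijective nuhat &
    forall a, {in H0, pi (nuhat a) =1 nubar (pi a)} }.

Variable J : H -> H.

Definition Jconj (T : H -> H) : H -> H := J \o T \o pinv setT J.

(* The order-one condition is an identity in B(H) between the bounded
   extensions T of [D, pi a] and N of nubar^2 (pi b); these are unique because
   H0 is dense.  In trs_eps and trs_regular the composites have domain H0.
   D is not asked to map H0 into itself, since that would exclude an unbounded
   D that is selfadjoint on H0. If D and J preserve H0, then so do both sides
   of these two identities. *)
Record twisted_real_spectral_triple (e e' : bool) : Prop :=
  TwistedRealSpectralTriple {
  trs_triple : spectral_triple;
  trs_twist : twist;
  trs_antiunitary : antiunitary dot J;
  trs_square : forall h, J (J h) = (-1) ^+ e *: h;
  trs_order_zero : forall a b h,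
    pi a (Jconj (pi b) h) = Jconj (pi b) (pi a h);
  trs_order_one : forall a b T N,
    extends H0 (commutator D (pi a)) T ->
    extends H0 (nubar (nubar (pi b))) N ->
    forall h, T (Jconj N h) = Jconj (pi b) (T h);
  trs_eps : forall h, H0 h ->
    [/\ H0 (J (nu h)), V (J (D h)) &
        D (J (nu h)) = (-1) ^+ e' *: nu (J (D h))];
  trs_regular : forall h, H0 h -> H0 (J h) /\ nu (J (nu h)) = J h }.

Record even_grading (gamma : H -> H) (e'' : bool) : Prop := EvenGrading {
  gr_linear : linear gamma;
  gr_selfadjoint : forall x y, dot (gamma x) y = dot x (gamma y);
  gr_involutive : involutive gamma;
  gr_commute : forall a h, gamma (pi a h) = pi a (gamma h);
  gr_domain : set_fun H0 H0 gamma;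
  gr_anticommute : forall h, H0 h -> gamma (D h) = - D (gamma h);
  (* as gamma is an involution, this forces equality of the domains of
     nu^2 gamma and gamma nu^2 *)
  gr_twist : forall h, V h -> V (nu h) ->
    [/\ V (gamma h), V (nu (gamma h)) & nu (nu (gamma h)) = gamma (nu (nu h))];
  gr_real : forall h, gamma (J h) = (-1) ^+ e'' *: J (gamma h) }.

End TwistedRealSpectralTriples.

Definition real_spectral_triple (R : realType) (A : algType R[i])
    (star : A -> A) (H : completeNormedModType R[i])
    (dot : {dot H for Num.conj}) (pi : A -> H -> H) (H0 : set H) (D J : H -> H)
    (e e' : bool) :=
  twisted_real_spectral_triple star dot pi H0 D setT idfun J e e'.

(* Main.v *)
(* Let G be the closure of the graph of D, k' = J k J^-1 and l' = k'^-1, both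
   bounded, selfadjoint and preserving the domain of D. The map
   (u, v) |-> (l' u, k' v) is a homeomorphism taking the graph of D to the graph
   of D_k = k' D k', and it commutes with taking adjoints of graphs because k'
   is symmetric; hence D_k is essentially selfadjoint.

   For the resolvent of D_k, write D_k - c = k' (D - c l'^2) k'. Invertibility of
   D - c l'^2 for some purely imaginary c follows from that of D - z by the
   method of continuity: along a segment of bounded operators M on which
   |Im <M u, u>| >= s |u|^2, the operators D - M satisfy a uniform a priori
   estimate, and solvability propagates by steps of fixed length through a
   contraction argument. The second resolvent identity
   (D - c l'^2)^-1 = (D - z)^-1 (1 + (c l'^2 - z) (D - c l'^2)^-1)
   then gives compactness.

   The order-one condition reduces to the one of D, since a bounded extension T
   of [D_k, pi a] = k' [D, pi a] k' yields the bounded extension l' T l' of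
   [D, pi a]. The remaining conditions are algebraic: pi a commutes with k',
   and J k' = k J. *)
Require Import Defs.
From HB Require Import structures.
From mathcomp Require Import all_boot all_order all_algebra.
From mathcomp Require Import complex.
From mathcomp Require Import ring.
From mathcomp Require Import all_classical all_reals all_analysis.
Import Order.TTheory GRing.Theory Num.Theory.
Import numFieldNormedType.Exports.
Local Open Scope classical_set_scope.
Local Open Scope ring_scope.
Local Open Scope complex_scope.

(** * Bounded operators, compactness under composition, and a fixed-point principle *)

Section BoundedOperators.
Set Implicit Arguments.
Unset Strict Implicit.
Variables (R : realType) (H : completeNormedModType R[i]).
Implicit Types (X : set H) (S T : H -> H).

(** In the partial order of [R[i]], [0 <= x] forces [x] to be real, so the archimedean property of
    [R] applies to its real part. *)
Lemma complex_archimedean (x : R[i]) : 0 <= x -> exists n : nat, x < n%:R.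
Proof.
move=> x0; have xE : x = (complex.Re x)%:C.
  by case: x x0 => a b; rewrite lecE /= => /andP[/eqP-> _].
have r0 : 0 <= complex.Re x by rewrite -lecR -xE.
exists (Num.bound (complex.Re x)).
by rewrite xE -(rmorph_nat (real_complex R)) ltcR archi_boundP.
Qed.

(** A bound in [R[i]] may be negative or not real. It then cannot hold at any nonzero vector, so [X]
    lies in [[set 0]] and the constant 1 serves. *)
Lemma bounded_on_gt0 X f :
  bounded_on X f -> exists2 M : R[i], 0 < M & forall h, X h -> `|f h| <= M * `|h|.
Proof.
case=> M fM; have [M0|nM0] := boolP (0 <= M).
  exists (M + 1); first by rewrite ltr_wpDl.
  move=> h Xh; apply: le_trans (fM h Xh) _.
  by rewrite ler_wpM2r// lerDl.
exists 1 => // h Xh; have := fM h Xh.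
have [->|h0 fh] := eqVneq h 0; first by rewrite normr0 !mulr0.
case/negP: nM0; rewrite -(pmulr_lge0 _ (_ : 0 < `|h|)) ?normr_gt0//.
exact: le_trans fh.
Qed.

Lemma linear_add T : linear T -> {morph T : x y / x + y}.
Proof. by move=> lT x y; have := lT 1 x y; rewrite !scale1r. Qed.

Lemma linear_zero T : linear T -> T 0 = 0.
Proof. by move=> lT; apply: (addrI (T 0)); rewrite -(linear_add lT) !addr0. Qed.

Lemma linear_scale T : linear T -> forall c, {morph T : x / c *: x}.
Proof.
by move=> lT c x; have := lT c x 0; rewrite (linear_zero lT) !addr0.
Qed.

Lemma linear_opp T : linear T -> {morph T : x / - x}.
Proof. by move=> lT x; rewrite -(scaleN1r x) (linear_scale lT) scaleN1r. Qed.

Lemma linear_sub T : linear T -> {morph T : x y / x - y}.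
Proof. by move=> lT x y; rewrite linear_add// linear_opp. Qed.

Lemma bounded_op_continuous T : bounded_op T -> continuous T.
Proof.
case=> lT /bounded_on_gt0[M M0 TM] x; apply/cvgrPdist_lt => /= e e0.
near=> y; rewrite -linear_sub//; apply: le_lt_trans (TM _ I) _.
rewrite mulrC -ltr_pdivlMr//; near: y.
by apply: cvgr_dist_lt; rewrite ?divr_gt0.
Unshelve. all: by end_near. Qed.

Lemma bounded_op_comp S T : bounded_op S -> bounded_op T -> bounded_op (S \o T).
Proof.
case=> lS /bounded_on_gt0[M M0 SM] [lT /bounded_on_gt0[N N0 TN]]; split.
  by move=> c x y /=; rewrite lT lS.
exists (M * N) => h _ /=; apply: le_trans (SM _ I) _.
by rewrite -mulrA ler_wpM2l ?(ltW M0)// TN.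
Qed.

Lemma bounded_op_id : bounded_op (@idfun H).
Proof. by split=> //; exists 1 => h _; rewrite mul1r. Qed.

Lemma bounded_op_add S T :
  bounded_op S -> bounded_op T -> bounded_op (fun h => S h + T h).
Proof.
case=> lS [M SM] [lT [N TN]]; split.
  by move=> c x y; rewrite lS lT scalerDr addrACA.
exists (M + N) => h _; rewrite mulrDl (le_trans (ler_normD _ _))//.
by rewrite lerD ?SM ?TN.
Qed.

Lemma bounded_op_scale c T : bounded_op T -> bounded_op (fun h => c *: T h).
Proof.
case=> lT [N TN]; split.
  by move=> d x y; rewrite lT scalerDr !scalerA mulrC.
exists (`|c| * N) => h _; rewrite normrZ -mulrA ler_wpM2l// TN//.
Qed.

Lemma compact_op_comp S L T : bounded_op S -> bounded_op L -> bounded_op T ->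
  compact_op L -> compact_op (S \o L \o T).
Proof.
move=> bS [lL _] [lT /bounded_on_gt0[M M0 TM]].
rewrite /compact_op precompactE => cL.
(* As [T] maps the unit ball into the ball of radius [M], the image to be covered lies in [S]
   applied to [M] times the image of the unit ball under [L]. *)
pose K := (fun h => S (M *: h)) @` closure (L @` [set h | `|h| <= 1]).
have cK : compact K.
  apply: continuous_compact => //; apply: continuous_subspaceT.
  apply: bounded_op_continuous; apply: bounded_op_comp bS _.
  exact: bounded_op_scale bounded_op_id.
exists K; last by split=> //; exact: compact_closed (@norm_hausdorff _ _) _.
move=> _ [h /= h1 <-]; exists (L (M^-1 *: T h)).
  apply: subset_closure; exists (M^-1 *: T h) => //=.
  rewrite normrZ gtr0_norm ?invr_gt0// mulrC ler_pdivrMr// mul1r.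
  by apply: le_trans (TM _ I) _; rewrite ler_piMr// ltW.
by rewrite (linear_scale lL) scalerA divff ?gt_eqF// scale1r.
Qed.

Lemma closure_preimage (U V : topologicalType) (f : U -> V) A B :
  continuous f -> A `<=` f @^-1` B -> closure A `<=` f @^-1` (closure B).
Proof.
move=> cf AB; have : closed (f @^-1` closure B).
  by move/continuous_closedP: cf; apply; exact: closed_closure.
move/closure_id ->; apply: closureS => x /AB /= Bfx.
exact: subset_closure.
Qed.

Lemma half_contraction_fixpoint (F : H -> H) :
  (forall x y, `|F x - F y| <= 2^-1 * `|x - y|) -> exists x, F x = x.
Proof.
move=> hF; pose y n := iter n F 0; pose C := 2 * `|y 1%N - y 0%N|.
have h0 : (0 : R[i]) <= 2^-1 by rewrite invr_ge0 ler0n.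
have y1 n : `|y n.+1 - y n| <= 2^-1 ^+ n * `|y 1%N - y 0%N|.
  elim: n => [|n IH]; first by rewrite expr0 mul1r.
  apply: le_trans (hF _ _) _; rewrite exprS -mulrA.
  by rewrite ler_wpM2l.
(* The last factor is that of a partial geometric sum; with it the bound in the induction step
   closes as an equality. *)
have yd n m : `|y (n + m)%N - y n| <= C * 2^-1 ^+ n * (1 - 2^-1 ^+ m).
  elim: m => [|m IH]; first by rewrite addn0 !subrr normr0 mulr0.
  rewrite (le_trans (ler_distD (y (n + m)%N) _ _))// addnS.
  apply: le_trans (lerD (y1 _) IH) _; rewrite exprD /C exprS.
  set a := `|_|; set u := 2^-1 ^+ n; set v := 2^-1 ^+ m.
  rewrite le_eqVlt; apply/orP; left; apply/eqP.
  by field.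
have yC n m : (n <= m)%N -> `|y n - y m| <= C * 2^-1 ^+ n.
  move=> nm; rewrite distrC -(subnKC nm); apply: le_trans (yd _ _) _.
  rewrite ler_piMr ?mulr_ge0 ?exprn_ge0// lerBlDr lerDl exprn_ge0//.
have small (e : R[i]) : 0 < e -> exists n, C * 2^-1 ^+ n < e.
  move=> e0; have [n Cn] := complex_archimedean
    (divr_ge0 (mulr_ge0 (ler0n _ 2) (normr_ge0 (y 1%N - y 0%N))) (ltW e0)).
  exists n; rewrite exprVn ltr_pdivrMr ?exprn_gt0// mulrC -ltr_pdivrMr//.
  by apply: lt_le_trans Cn _; rewrite -natrX ler_nat ltnW// ltn_expl.
have cy : cvgn y.
  apply/cauchy_cvgP; apply: cauchy_exP => e e0.
  have [n Cn] := small e e0; exists (y n); exists n => //= m /= nm.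
  by rewrite -ball_normE /=; apply: le_lt_trans (yC _ _ nm) _.
exists (limn y); apply/esym; apply: cvg_lim => //.
apply/cvgrPdist_lt => e e0; near_simpl; apply: near_inftyS.
near=> n => /=; apply: le_lt_trans (hF _ _) _.
rewrite (@le_lt_trans _ _ `|limn y - y n|)//.
  by rewrite ler_piMl// invf_le1// ler1n.
by near: n; move/cvgrPdist_lt: cy; apply.
Unshelve. all: by end_near. Qed.

End BoundedOperators.

(** * Hilbert space geometry and adjoint graphs *)

Section HilbertSpace.
Set Implicit Arguments.
Unset Strict Implicit.
Variables (R : realType) (H : completeNormedModType R[i]).
Variable dot : {dot H for Num.conj}.
Implicit Types (k T : H -> H) (G : set (H * H)).

Lemma dotC x y : dot x y = Num.conj (dot y x).
Proof. by rewrite hermC /= expr0 mul1r. Qed.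

Lemma dotDl x y z : dot (x + y) z = dot x z + dot y z.
Proof. exact: linearDl. Qed.

Lemma dotBl x y z : dot (x - y) z = dot x z - dot y z.
Proof. exact: linearBl. Qed.

Lemma dotZl c x z : dot (c *: x) z = c * dot x z.
Proof. exact: linearZl_LR. Qed.

Lemma dotDr x y z : dot z (x + y) = dot z x + dot z y.
Proof. exact: linearDr. Qed.

Lemma dotBr x y z : dot z (x - y) = dot z x - dot z y.
Proof. exact: linearBr. Qed.

Lemma dotZr c x z : dot z (c *: x) = Num.conj c * dot z x.
Proof. exact: linearZr_LR. Qed.

Lemma dot_injr x y : (forall q, dot q x = dot q y) -> x = y.
Proof.
move=> xy; apply/subr0_eq/eqP; rewrite -(dnorm_eq0 dot) dotBr xy subrr //.
Qed.

(* Polarization: a sesquilinear form vanishing on the diagonal vanishes. *)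
Lemma positive_symmetric k : linear k -> (forall h, 0 <= dot (k h) h) ->
  forall x y, dot (k x) y = dot x (k y).
Proof.
move=> lk k0; pose s x y := dot (k x) y - dot x (k y).
have sD x y x' y' : s (x + x') (y + y') = s x y + s x y' + s x' y + s x' y'.
  rewrite /s !(linear_add lk) !dotDl !dotDr; ring.
have sh h : s h h = 0.
  by rewrite /s (dotC h) (CrealP (ger0_real (k0 h))) subrr.
have sZr c x y : s x (c *: y) = Num.conj c * s x y.
  by rewrite /s (linear_scale lk) !dotZr mulrBr.
have sZl c x y : s (c *: x) y = c * s x y.
  by rewrite /s (linear_scale lk) !dotZl mulrBr.
move=> x y; apply/subr0_eq; rewrite -/(s x y).
have e1 : s y x = - s x y.
  have := sD x x y y; rewrite !sh addr0 add0r => /esym/eqP.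
  by rewrite addrC addr_eq0 => /eqP.
have := sD x x ('i *: y) ('i *: y); rewrite !sh addr0 add0r sZr sZl e1 conjCi.
move/esym/eqP; rewrite mulrN mulNr -opprD oppr_eq0 -mulr2n mulrn_eq0 /=.
by rewrite mulf_eq0 (negPf (neq0Ci _)) => /eqP.
Qed.

Lemma adjoint_graph_subspace G c p q :
  adjoint_graph dot G p -> adjoint_graph dot G q ->
  adjoint_graph dot G (c *: p + q).
Proof.
by move=> Gp Gq r Gr /=; rewrite !dotDr !dotZr Gp// Gq.
Qed.

(** Testing [(u, v)] against itself in the adjoint condition gives [dot v u = dot u v]. *)
Lemma selfadjoint_graph_real G u v :
  adjoint_graph dot G = G -> G (u, v) -> dot v u \is Num.real.
Proof.
move=> GE Guv; have := Guv; rewrite -GE => /(_ _ Guv) /= e.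
by apply/CrealP; rewrite -dotC e.
Qed.

Hypothesis hn : hilbert_norm dot.

Lemma cauchy_schwarz x y : `|dot x y| <= `|x| * `|y|.
Proof.
have [->|y0] := eqVneq y 0; first by rewrite linear0r !normr0 mulr0.
have yy0 : 0 < `|y| by rewrite normr_gt0.
have yN : dot y y != 0 by rewrite dnorm_eq0.
pose a := dot x y / dot y y.
have : 0 <= dot (x - a *: y) (x - a *: y) by exact: dnorm_ge0.
rewrite dotBr !dotBl !dotZr !dotZl /a divfK//.
rewrite subrr subr0 subr_ge0 (dotC y x) mulrAC -normCK -!hn ler_pdivrMr ?exprn_gt0// -exprMn.
by rewrite ler_pXn2r// ?nnegrE ?mulr_ge0.
Qed.

Lemma Im_le_norm (z : R[i]) : `|'Im z| <= `|z|.
Proof.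
rewrite -ler_sqr ?nnegrE// (normC2_Re_Im z) real_normK ?Creal_Im// lerDr.
by rewrite real_exprn_even_ge0 ?Creal_Re.
Qed.

(** * Perturbation of resolvents by the method of continuity *)

Section PerturbationTheory.
Variable G : set (H * H).
Hypothesis Glin : forall c p q, G p -> G q -> G (c *: p + q).

Let Gsub u v u' v' : G (u, v) -> G (u', v') -> G (u - u', v - v').
Proof.
move=> Gu Gu'; have := Glin (-1) Gu' Gu.
by rewrite [_ + _]surjective_pairing /= !scaleN1r ![- _ + _]addrC.
Qed.

(** Surjectivity of [D - M], phrased for a linear relation [G] because the closure of the graph of
    [D] is not given as a function on a domain. *)
Definition surjective_at (M : H -> H) :=
  forall f, exists u v, G (u, v) /\ v - M u = f.

(* A solution of v - N u = f is a fixed point of u |-> u', where u' solves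
   v' - M u' = f + (N u - M u). *)
Lemma surjective_at_near (M N : H -> H) (C d : R[i]) : linear M -> 0 < C ->
  (forall u v, G (u, v) -> `|u| <= C * `|v - M u|) ->
  (forall u u', `|(N u - M u) - (N u' - M u')| <= d * `|u - u'|) ->
  C * d <= 2^-1 -> surjective_at M -> surjective_at N.
Proof.
move=> lM C0 GC NM Cd sM f.
have /choice[F hF] : forall u, exists u', exists v',
    G (u', v') /\ v' - M u' = f + (N u - M u).
  by move=> u; apply: sM.
have [x y|u Fu] := @half_contraction_fixpoint _ _ F.
  have [[v [Gv Ev]] [w [Gw Ew]]] := (hF x, hF y).
  apply: le_trans (GC _ _ (Gsub Gv Gw)) _.
  have -> : v - w - M (F x - F y) = (N x - M x) - (N y - M y).
    by rewrite (linear_sub lM) opprD addrACA -opprD Ev Ew opprD addrACA subrr add0r.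
  apply: le_trans (_ : C * (d * `|x - y|) <= _); first by rewrite ler_wpM2l ?(ltW C0).
  by rewrite mulrA ler_wpM2r.
have [v [Gv Ev]] := hF u; exists u, v; rewrite -{1}Fu; split=> //.
by move: Ev; rewrite Fu addrA => /addIr ->; rewrite addrK.
Qed.

(** The constant [C] is the same along the whole segment. Cutting it into [n > 2CK] equal pieces
    makes [C] times each increment at most 1/2, so solvability passes from each division point to
    the next. *)
Lemma surjective_at_homotopy (M N : H -> H) (C K : R[i]) :
  linear M -> linear N -> 0 < C -> 0 <= K ->
  (forall u, `|N u - M u| <= K * `|u|) ->
  (forall t, 0 <= t <= 1 -> forall u v, G (u, v) ->
     `|u| <= C * `|v - (M u + t *: (N u - M u))|) ->
  surjective_at M -> surjective_at N.
Proof.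
move=> lM lN C0 K0 NMK GC sM.
have C2K : 0 <= C * 2 * K by rewrite !mulr_ge0 ?ler0n ?(ltW C0).
have [n nCK] := complex_archimedean C2K.
have n0 : 0 < n%:R :> R[i] by apply: le_lt_trans nCK.
pose P (t : R[i]) u := M u + t *: (N u - M u).
have lP t : linear (P t).
  move=> c u v; rewrite /P lM lN opprD addrACA -scalerBr !scalerDr.
  by rewrite -addrACA !scalerA [t * c]mulrC.
have PB t t' u : P t' u - P t u = (t' - t) *: (N u - M u).
  by rewrite /P opprD addrACA subrr add0r -scalerBl.
have sP j : (j <= n)%N -> surjective_at (P (j%:R / n%:R)).
  elim: j => [_|j IH jn].
    move=> f; have [u [v [Guv E]]] := sM f; exists u, v; split=> //.
    by rewrite /P mul0r scale0r addr0.
  have := IH (ltnW jn); apply: (@surjective_at_near _ _ C (K / n%:R)) => //.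
  - move=> u v; apply: GC; rewrite divr_ge0 ?ler0n//= ler_pdivrMr// mul1r.
    by rewrite ler_nat ltnW.
  - move=> u u'; rewrite !PB -scalerBr opprD addrACA -opprD.
    rewrite -(linear_sub lN) -(linear_sub lM).
    rewrite normrZ -mulrBl -natrB ?leqnSn// subSnn.
    rewrite normrM normr1 mul1r normfV gtr0_norm// mulrC mulrAC.
    by rewrite ler_wpM2r// invr_ge0 ltW.
  - rewrite mulrA ler_pdivrMr// -ler_pdivrMl ?invr_gt0//.
    by rewrite invrK mulrC mulrAC ltW.
have := sP n (leqnn n); rewrite divff ?gt_eqF// => sP1 f.
have [u [v [Guv E]]] := sP1 f; exists u, v; split=> //.
by move: E; rewrite /P scale1r [M u + _]addrC subrK.
Qed.

Hypothesis Greal : forall u v, G (u, v) -> dot v u \is Num.real.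

(** Take the imaginary part of [dot w u]: the real number [dot v u] drops out, and the contributions
    of [c] and of [B] carry the same sign, so they cannot cancel. Cauchy-Schwarz then turns the
    lower bound on this imaginary part into one on the norm of [w]. *)
Lemma lower_bound_perturbed (B : H -> H) (b s t c z : R[i]) (e : bool) u v :
  (forall u, b * `|u| ^+ 2 <= dot (B u) u) ->
  0 < s -> s <= b -> 0 <= (-1) ^+ e * 'Im z -> 0 <= t <= 1 ->
  G (u, v) ->
  c = z + (-1) ^+ e * s * 'i ->
  `|u| <= s^-1 * `|v - (c *: u + t *: (((-1) ^+ e * 'i) *: B u - c *: u))|.
Proof.
move=> bB s0 sb ez /andP[t0 t1] Guv cE; set w := v - _.
have [->|u0] := eqVneq u 0.
  by rewrite normr0 mulr_ge0// invr_ge0 ltW.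
have un : 0 < `|u| by rewrite normr_gt0.
rewrite mulrC ler_pdivlMr// -(ler_pM2r un) mulrAC -expr2 mulrC.
apply: le_trans (cauchy_schwarz w u); apply: le_trans (Im_le_norm _).
have Bu := bB u; have BR : dot (B u) u \is Num.real.
  by apply: ger0_real; apply: le_trans Bu; rewrite mulr_ge0 ?exprn_ge0// (le_trans (ltW s0)).
have eR : ((-1) ^+ e : R[i]) \is Num.real.
  by case: (e); rewrite ?expr0 ?expr1 ?realN real1.
have sR : s \is Num.real by exact: gtr0_real.
have tR : t \is Num.real by exact: ger0_real.
have nR : `|u| ^+ 2 \is Num.real by rewrite ger0_real// exprn_ge0.
have zE : z = 'Re z + 'i * ((-1) ^+ e * ((-1) ^+ e * 'Im z)).
  by rewrite signrMK -Crect.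
have ImE : 'Im (dot w u) =
    - ((-1) ^+ e * ((1 - t) * ((-1) ^+ e * 'Im z + s) * `|u| ^+ 2 + t * dot (B u) u)).
  have -> : dot w u = (dot v u - (1 - t) * 'Re z * `|u| ^+ 2) +
      'i * - ((-1) ^+ e * ((1 - t) * ((-1) ^+ e * 'Im z + s) * `|u| ^+ 2
                           + t * dot (B u) u)).
    rewrite /w dotBl dotDl !dotZl dotBl !dotZl -hn cE {1 2}zE.
    by move: ((-1) ^+ e * 'Im z) => y; ring.
  by rewrite Im_rect ?(realB, realN, realM, realD, real1, Greal Guv, Creal_Im, Creal_Re).
rewrite ImE normrN normrM normr_sign mul1r.
have lowX : s * `|u| ^+ 2 <=
    (1 - t) * ((-1) ^+ e * 'Im z + s) * `|u| ^+ 2 + t * dot (B u) u.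
  have -> : s * `|u| ^+ 2 = (1 - t) * s * `|u| ^+ 2 + t * (s * `|u| ^+ 2) by ring.
  apply: lerD.
    rewrite ler_wpM2r ?exprn_ge0// ler_wpM2l ?subr_ge0// lerDr//.
  by rewrite ler_wpM2l// (le_trans _ Bu)// ler_wpM2r ?exprn_ge0.
by rewrite ger0_norm// (le_trans _ lowX)// mulr_ge0 ?exprn_ge0 ?(ltW s0).
Qed.

(* Starting from the resolvent at z, move first to z +- i s off the real axis,
   so that Im <v - M u, u> >= s |u|^2 along the segment from M = z +- i s to
   M = +- i B. *)
Lemma perturbed_resolvent (B S : H -> H) (b z : R[i]) :
  bounded_op B -> 0 < b -> (forall u, b * `|u| ^+ 2 <= dot (B u) u) ->
  is_resolvent G z S -> compact_op S ->
  exists c T, [/\ bounded_op T, compact_op T,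
    forall f, G (T f, f + c *: B (T f)) &
    forall u v, G (u, v) -> T (v - c *: B u) = u].
Proof.
move=> bB b0 Bb [bS SG SGK] cS; have [lS] := bS.
case/bounded_on_gt0=> C C0 SC.
have SK u v : G (u, v) -> S (v - z *: u) = u by exact: (SGK (u, v)).
(* Chosen to satisfy both [s <= b], for the a priori estimate, and [C * s <= 2^-1], so that the move
   from [z] to [c] is a single contraction step. *)
pose s := b / (1 + 2 * C * b).
have D0 : 0 < 2 * C * b by rewrite !mulr_gt0.
have D1 : 0 < 1 + 2 * C * b by rewrite addr_gt0.
have s0 : 0 < s by rewrite divr_gt0.
have sb : s <= b by rewrite ler_pdivrMr// ler_peMr ?(ltW b0)// lerDl ltW.
have Cs : C * s <= 2^-1.
  rewrite /s mulrA ler_pdivrMr// -ler_pdivrMl ?invr_gt0// invrK mulrA.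
  by rewrite lerDr.
(* The sign is such that the move by [s] leads away from the real axis; a real [z] is moved
   upwards. *)
pose e := 'Im z < 0; pose w : R[i] := (-1) ^+ e * 'i.
have ez : 0 <= (-1) ^+ e * 'Im z.
  rewrite /e; case: real_ltP; rewrite ?Creal_Im ?real0// => y0.
    by rewrite expr1 mulN1r oppr_ge0 ltW.
  by rewrite expr0 mul1r.
pose c := z + (-1) ^+ e * s * 'i.
have scale_linear a : linear (fun u : H => a *: u).
  by move=> x u v; rewrite scalerDr !scalerA mulrC.
have bwB : bounded_op (fun u => w *: B u) by exact: bounded_op_scale.
have surj_z : surjective_at (fun u => z *: u).
  by move=> f; exists (S f), (f + z *: S f); rewrite addrK; split.
have surj_c : surjective_at (fun u => c *: u).
  apply: (@surjective_at_near (fun u => z *: u) _ C s) => //.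
    by move=> u v Guv; rewrite -{1}(SK _ _ Guv); exact: SC.
  move=> u u'; rewrite -!scalerBl -scalerBr /c addrAC subrr add0r normrZ.
  by rewrite normrM normCi mulr1 normrM normr_sign mul1r gtr0_norm.
have est t : 0 <= t <= 1 -> forall u v, G (u, v) ->
    `|u| <= s^-1 * `|v - (c *: u + t *: (w *: B u - c *: u))|.
  by move=> t01 u v Guv; apply: lower_bound_perturbed ez t01 Guv _.
have surj_w : surjective_at (fun u => w *: B u).
  have : bounded_op (fun u => w *: B u + - c *: u).
    exact: bounded_op_add bwB (bounded_op_scale (- c) (bounded_op_id H)).
  case=> _ /bounded_on_gt0[K K0 NK].
  apply: (@surjective_at_homotopy (fun u => c *: u) _ s^-1 K) => //.
  - by case: bwB.
  - by rewrite invr_gt0.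
  - exact: ltW.
  - by move=> u; rewrite -scaleNr; exact: NK.
have est1 u v : G (u, v) -> `|u| <= s^-1 * `|v - w *: B u|.
  move=> Guv; have := est 1 _ _ _ Guv; rewrite ler01 lexx scale1r.
  by rewrite [c *: u + _]addrC subrK; apply.
have uniq u v u' v' : G (u, v) -> G (u', v') ->
    v - w *: B u = v' - w *: B u' -> u = u'.
  move=> Gu Gu' E; apply/subr0_eq/normr0_eq0/eqP.
  rewrite eq_le normr_ge0 andbT (le_trans (est1 _ _ (Gsub Gu Gu')))//.
  by rewrite (linear_sub bwB.1) opprD addrACA -opprD E subrr normr0 mulr0.
have TG f : exists u, G (u, f + w *: B u).
  by have [u [v [Guv <-]]] := surj_w f; exists u; rewrite subrK.
have [T {}TG] := choice TG.
have TK u v : G (u, v) -> T (v - w *: B u) = u.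
  by move=> Guv; apply: uniq (TG _) Guv _; rewrite addrK.
have bT : bounded_op T.
  split.
    move=> a f g; apply: uniq (TG _) (Glin a (TG f) (TG g)) _ => /=.
    rewrite addrK bwB.1 scalerDr.
    by rewrite addrACA addrK.
  by exists s^-1 => h _; have := est1 _ _ (TG h); rewrite addrK.
exists w, T; split=> //.
(* Second resolvent identity: [S] inverts [D - z], and applied to the pair [(T f, f + w *: B (T f))]
   of [G] this gives [T f = S (L f)]. *)
pose L f := f + (w *: B (T f) + - z *: T f).
have -> : T = idfun \o S \o L.
  apply/funext => f /=; rewrite /L addrA scaleNr.
  by rewrite (SK _ _ (TG f)).
apply: compact_op_comp => //; first exact: bounded_op_id.
apply: bounded_op_add (bounded_op_id H) _.
exact: bounded_op_add (bounded_op_comp bwB bT) (bounded_op_scale (- z) bT).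
Qed.

End PerturbationTheory.
End HilbertSpace.

(** * Selfadjointness and compact resolvent of [K D K] *)

Section Congruence.
Set Implicit Arguments.
Unset Strict Implicit.
Variables (R : realType) (H : completeNormedModType R[i]).
Variable dot : {dot H for Num.conj}.

(** By continuity the graph is already closed, and a pair in its adjoint is tested against every
    vector, which determines its second entry. *)
Lemma ess_selfadjoint_bounded T : bounded_op T ->
  (forall x y, dot (T x) y = dot x (T y)) -> ess_selfadjoint dot setT T.
Proof.
move=> bT sT; have lT := bT.1.
have cG : closure (graph setT T) = graph setT T.
  apply/esym/closure_id.
  have -> : graph setT T = (fun p => p.2 - T p.1) @^-1` [set 0].
    apply/seteqP; split=> p /=; first by case=> _ ->; rewrite subrr.
    by move/subr0_eq.
  have /continuous_closedP : continuous (fun p : H * H => p.2 - T p.1).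
    move=> p; apply: cvgB; first exact: cvg_snd.
    apply: continuous_comp; first exact: cvg_fst.
    exact: bounded_op_continuous.
  apply; apply: accessible_closed_set1; apply: hausdorff_accessible.
  exact: norm_hausdorff.
split; first split.
- by split=> //.
- by move=> O O0 _; rewrite setIT.
- by move=> c x y _ _; exact: lT.
rewrite cG; apply/seteqP; split=> p /=.
  move=> Gp; split=> //; apply: (@dot_injr _ _ dot) => q.
  by rewrite -(Gp (q, T q))//= sT.
by case=> _ E q [_ Eq]; rewrite E Eq sT.
Qed.

Variables (X : set H) (D K L : H -> H).
Hypotheses (bK : bounded_op K) (bL : bounded_op L).
Hypotheses (KL : cancel K L) (LK : cancel L K).
Hypothesis symK : forall x y, dot (K x) y = dot x (K y).
Hypothesis symL : forall x y, dot (L x) y = dot x (L y).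
Hypotheses (XK : set_fun X X K) (XL : set_fun X X L).

Lemma graph_congruence p :
  graph X (K \o D \o K) p <-> graph X D (K p.1, L p.2).
Proof.
split=> -[/= Xp E]; split=> /=; first exact: XK.
- by rewrite E /= KL.
- by rewrite -(KL p.1); exact: XL.
- by rewrite -E LK.
Qed.

Lemma closure_graph_congruence p : closure (graph X (K \o D \o K)) p <->
  closure (graph X D) (K p.1, L p.2).
Proof.
have pair_cts S T : bounded_op S -> bounded_op T ->
    continuous (fun p : H * H => (S p.1, T p.2)).
  move=> bS bT q; apply: cvg_pair => /=.
    apply: continuous_comp; first exact: cvg_fst.
    exact: bounded_op_continuous.
  apply: continuous_comp; first exact: cvg_snd.
  exact: bounded_op_continuous.
split.
  apply: (closure_preimage (pair_cts _ _ bK bL)) => q.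
  by rewrite /preimage /= => /graph_congruence.
have sub : graph X D `<=` (fun q => (L q.1, K q.2)) @^-1` graph X (K \o D \o K).
  by move=> q Gq; apply/graph_congruence; rewrite /= KL LK -surjective_pairing.
move/(closure_preimage (pair_cts _ _ bL bK) sub) => /=.
by rewrite KL LK -surjective_pairing.
Qed.

(** Moving [K] and [L] across the inner product turns the adjoint condition of [p] against
    [(L q.1, K q.2)] into that of [(K p.1, L p.2)] against [q]. *)
Lemma adjoint_graph_congruence (G G' : set (H * H)) :
  (forall p, G' p <-> G (K p.1, L p.2)) ->
  forall p, adjoint_graph dot G' p <-> adjoint_graph dot G (K p.1, L p.2).
Proof.
move=> GG' p; split=> Gp q Gq /=.
  rewrite -symK -symL; apply: (Gp (L q.1, K q.2)).
  by apply/GG'; rewrite /= KL LK -surjective_pairing.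
by rewrite -(LK q.2) symK -(KL q.1) (symL (K _)); apply: (Gp (K q.1, L q.2)); apply/GG'.
Qed.

Lemma densely_defined_congruence :
  densely_defined X D -> densely_defined X (K \o D \o K).
Proof.
case=> sX dX lD; split=> // c x y Xx Xy /=.
by rewrite bK.1 lD ?bK.1//; exact: XK.
Qed.

Lemma selfadjoint_congruence :
  selfadjoint dot X D -> selfadjoint dot X (K \o D \o K).
Proof.
case=> dD aD; split; first exact: densely_defined_congruence.
apply/seteqP; split=> p.
  by move/(adjoint_graph_congruence graph_congruence); rewrite aD => /graph_congruence.
by move/graph_congruence; rewrite -{1}aD => /(adjoint_graph_congruence graph_congruence).
Qed.

Lemma ess_selfadjoint_congruence :
  ess_selfadjoint dot X D -> ess_selfadjoint dot X (K \o D \o K).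
Proof.
case=> dD aD; split; first exact: densely_defined_congruence.
apply/seteqP; split=> p.
  move/(adjoint_graph_congruence closure_graph_congruence); rewrite aD.
  by move/closure_graph_congruence.
move/closure_graph_congruence; rewrite -{1}aD.
by move/(adjoint_graph_congruence closure_graph_congruence).
Qed.

(* K (D - c L^2) K = K D K - c *)
Lemma compact_resolvent_congruence : hilbert_norm dot ->
  ess_selfadjoint dot X D -> compact_resolvent X D ->
  compact_resolvent X (K \o D \o K).
Proof.
move=> hn [_ aD] [z [S [rS cS]]].
have [M M0 KM] := bounded_on_gt0 bK.2.
have b0 : 0 < M ^- 2 by rewrite invr_gt0 exprn_gt0.
(* By symmetry the right side is the squared norm of [L u], while [u = K (L u)] has norm at most [M]
   times that of [L u]. *)
have LLb u : M ^- 2 * `|u| ^+ 2 <= dot ((L \o L) u) u.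
  rewrite /= symL -hn mulrC ler_pdivrMr ?exprn_gt0// mulrC -exprMn.
  by rewrite ler_pXn2r ?nnegrE ?mulr_ge0 ?(ltW M0)// -{1}(LK u) KM.
have [||c [T [bT cT TG TK]]] := perturbed_resolvent hn _ _
  (bounded_op_comp bL bL) b0 LLb rS cS.
(* The closed graph is linear because it is its own adjoint, and adjoint graphs are always
   linear. *)
- by move=> c p q; rewrite -aD; exact: adjoint_graph_subspace.
- by move=> u v; exact: selfadjoint_graph_real.
exists c, (L \o T \o L); split; last exact: compact_op_comp.
split.
- exact: bounded_op_comp (bounded_op_comp bL bT) bL.
- move=> h; apply/closure_graph_congruence => /=.
  rewrite LK (linear_add bL.1) (linear_scale bL.1); exact: (TG (L h)).
- move=> p /closure_graph_congruence /TK /= E.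
  by rewrite /= (linear_sub bL.1) (linear_scale bL.1) -{1}(KL p.1) E KL.
Qed.

End Congruence.

(** * Inverses, inner automorphisms and density *)

Section Inverses.
Set Implicit Arguments.
Unset Strict Implicit.

Lemma pinv_setT (U : pointedType) (f g : U -> U) :
  cancel f g -> cancel g f -> pinv setT f = g.
Proof.
move=> fK gK; apply/funext => h; rewrite -{1}(gK h) pinvKV ?inE//.
by move=> u v _ _; exact: (can_inj fK).
Qed.

(** Supplies the automorphism [nuhat] of the twist; its inverse is [a |-> x * a * y]. *)
Lemma inner_automorphism (F : nzRingType) (A : algType F) (x y : A) :
  x * y = 1 -> y * x = 1 ->
  exists2 f : {lrmorphism A -> A}, bijective f & forall a, f a = y * a * x.
Proof.
move=> xy yx; pose f a := y * a * x.
have fL : linear f by move=> c a b; rewrite /f mulrDr mulrDl -scalerAr -scalerAl.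
have fM : monoid_morphism f.
  by split=> [|a b]; rewrite /f ?mulr1 // -!mulrA [x * (y * _)]mulrA xy mul1r.
pose m : {lrmorphism A -> A} :=
  HB.pack f (GRing.isLinear.Build _ _ _ _ _ fL) (GRing.isMonoidMorphism.Build _ _ _ fM).
exists m => //; exists (fun a => x * a * y) => a /=; rewrite /f !mulrA.
  by rewrite xy mul1r -mulrA xy mulr1.
by rewrite yx mul1r -mulrA yx mulr1.
Qed.

(** The set where [S] and [T] differ is open, so if nonempty it would meet [X]. *)
Lemma bounded_op_dense_eq (R : realType) (H : completeNormedModType R[i])
    (X : set H) (S T : H -> H) :
  dense X -> bounded_op S -> bounded_op T -> {in X, S =1 T} -> S =1 T.
Proof.
move=> dX bS bT ST h; apply: contrapT => nST.
have bU : bounded_op (fun u => S u + -1 *: T u).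
  exact: bounded_op_add bS (bounded_op_scale _ bT).
pose O : set H := [set u | S u + -1 *: T u != 0].
have oO : open O.
  have -> : O = (fun u => S u + -1 *: T u) @^-1` (~` [set 0]).
    by apply/seteqP; split=> u /= /eqP.
  move/bounded_op_continuous/continuousP: bU; apply; apply: closed_openC.
  apply: accessible_closed_set1; apply: hausdorff_accessible.
  exact: norm_hausdorff.
have [|u [/= /eqP Ou Xu]] := dX O _ oO.
  by exists h; apply/eqP; rewrite scaleN1r => /subr0_eq.
by apply: Ou; rewrite ST ?inE// scaleN1r subrr.
Qed.

End Inverses.

(** * Conjugation of operators by an antiunitary [J] with [J^2] a sign *)

Section RealStructure.
Set Implicit Arguments.
Unset Strict Implicit.
Variables (R : realType) (H : completeNormedModType R[i]).
Variable dot : {dot H for Num.conj}.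
Variables (J : H -> H) (e : bool).
Hypothesis hn : hilbert_norm dot.
Hypothesis aJ : antiunitary dot J.
Hypothesis JJ : forall h, J (J h) = (-1) ^+ e *: h.

Lemma antiunitary_add : {morph J : x y / x + y}.
Proof.
by case: aJ => _ lJ _ x y; have := lJ 1 x y; rewrite rmorph1 !scale1r.
Qed.

Lemma antiunitary_scale c x : J (c *: x) = Num.conj c *: J x.
Proof.
case: aJ => _ lJ _; have J0 : J 0 = 0.
  by apply: (addrI (J 0)); rewrite -antiunitary_add !addr0.
by have := lJ c x 0; rewrite J0 !addr0.
Qed.

Lemma antiunitary_sign (n : bool) x : J ((-1) ^+ n *: x) = (-1) ^+ n *: J x.
Proof. by rewrite antiunitary_scale rmorph_sign. Qed.

Lemma antiunitary_norm x : `|J x| = `|x|.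
Proof.
case: aJ => _ _ dJ.
by apply/eqP; rewrite -(eqrXn2 (n := 2))// !hn dJ.
Qed.

Lemma pinv_antiunitary : pinv setT J = (fun h => (-1) ^+ e *: J h).
Proof.
apply: pinv_setT => h; last rewrite antiunitary_sign;
  by rewrite JJ scalerA -expr2 sqrr_sign scale1r.
Qed.

Lemma JconjE T h : Jconj J T h = J (T ((-1) ^+ e *: J h)).
Proof. by rewrite /Jconj pinv_antiunitary. Qed.

Lemma Jconj_comp S T h : Jconj J (S \o T) h = Jconj J S (Jconj J T h).
Proof.
by rewrite !JconjE JJ scalerA -expr2 sqrr_sign scale1r.
Qed.

Lemma JconjJ T h : Jconj J T (J h) = J (T h).
Proof. by rewrite JconjE JJ scalerA -expr2 sqrr_sign scale1r. Qed.

Lemma J_Jconj T h : linear T -> J (Jconj J T h) = T (J h).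
Proof.
move=> lT; rewrite JconjE JJ (linear_scale lT) scalerA -expr2 sqrr_sign.
by rewrite scale1r.
Qed.

Lemma Jconj_cancel S T : cancel S T -> cancel (Jconj J S) (Jconj J T).
Proof.
move=> ST h; rewrite -Jconj_comp JconjE /= ST.
by rewrite antiunitary_sign JJ scalerA -expr2 sqrr_sign scale1r.
Qed.

Lemma bounded_op_Jconj T : bounded_op T -> bounded_op (Jconj J T).
Proof.
case=> lT [M TM]; split.
  move=> c x y; rewrite !JconjE antiunitary_add antiunitary_scale scalerDr.
  rewrite scalerA [_ * Num.conj c]mulrC -scalerA lT antiunitary_add.
  by rewrite antiunitary_scale conjCK.
exists M => h _; rewrite JconjE antiunitary_norm (le_trans (TM _ I))//.
by rewrite normrZ normr_sign mul1r antiunitary_norm.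
Qed.

Lemma Jconj_symmetric T : linear T ->
  (forall x y, dot (T x) y = dot x (T y)) ->
  forall x y, dot (Jconj J T x) y = dot x (Jconj J T y).
Proof.
case: aJ => _ _ dJ lT sT.
(* Up to the sign of [J^2], [J] is its own antilinear adjoint; the signs from the two sides agree in
   the end. *)
have dJl u v : dot (J u) v = (-1) ^+ e * dot (J v) u.
  by rewrite -(dJ u (J v)) JJ dotZr rmorph_sign mulrA -expr2 sqrr_sign mul1r.
have dJr u v : dot u (J v) = (-1) ^+ e * dot v (J u).
  by rewrite -(dJ (J v) u) JJ dotZl.
move=> x y; rewrite !JconjE dJl dJr.
by rewrite !(linear_scale lT) dotZr dotZl rmorph_sign sT.
Qed.

End RealStructure.

(** * The conformally rescaled triple and its twist *)

Section ConformalTwist.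
Set Implicit Arguments.
Unset Strict Implicit.
Variables (R : realType) (A : algType R[i]) (star : A -> A).
Variables (H : completeNormedModType R[i]) (dot : {dot H for Num.conj}).
Variables (pi : A -> H -> H) (H0 : set H) (D J : H -> H) (e e' : bool).
Hypothesis real_triple : real_spectral_triple star dot pi H0 D J e e'.
Variables x y : A.
Hypotheses (xy : x * y = 1) (yx : y * x = 1).
Hypothesis xpos : forall h, 0 <= dot (pi x h) h.
Hypothesis xbij : bijective (pi x).

Let k := pi x.
Let l := pi y.
Let k' := Jconj J k.
Let l' := Jconj J l.
Let Dk := k' \o D \o k'.
Let nu := l \o k'.

Let st := trs_triple real_triple.
Let rep := st_rep st.
Let hn := st_hilbert st.
Let aJ := trs_antiunitary real_triple.
Let JJ := trs_square real_triple.
Let ess := st_ess_selfadjoint st.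

Let bpi a : bounded_op (pi a) := srep_bounded rep a.
Let pi_linear a : linear (pi a) := (bpi a).1.

(** Unitality of [pi] is not among the axioms: [pi 1] fixes the range of [pi x], which is all of
    [H]. *)
Let pi1 h : pi 1 h = h.
Proof.
by case: xbij => g gK Kg; rewrite -(Kg h) -(srep_mul rep) mul1r.
Qed.

Let kK : cancel k l.
Proof. by move=> h; rewrite /k /l -(srep_mul rep) yx pi1. Qed.

Let lK : cancel l k.
Proof. by move=> h; rewrite /k /l -(srep_mul rep) xy pi1. Qed.

Lemma pinv_rep : pinv setT k = l.
Proof. exact: pinv_setT kK lK. Qed.

Let bk' : bounded_op k' := bounded_op_Jconj hn aJ JJ (bpi x).
Let bl' : bounded_op l' := bounded_op_Jconj hn aJ JJ (bpi y).
Let k'K : cancel k' l' := Jconj_cancel aJ JJ kK.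
Let l'K : cancel l' k' := Jconj_cancel aJ JJ lK.

Let symk : forall u v, dot (k u) v = dot u (k v).
Proof. exact: positive_symmetric (pi_linear x) xpos. Qed.

Let symk' : forall u v, dot (k' u) v = dot u (k' v).
Proof. exact: Jconj_symmetric aJ JJ _ (pi_linear x) symk. Qed.

Let syml : forall u v, dot (l u) v = dot u (l v).
Proof. by move=> u v; rewrite -{1}(lK v) -symk lK. Qed.

Let syml' : forall u v, dot (l' u) v = dot u (l' v).
Proof. by move=> u v; rewrite -{1}(l'K v) -symk' l'K. Qed.

Let H0J h : H0 h -> H0 (J h).
Proof. by case/(trs_regular real_triple). Qed.

Let H0pi a : set_fun H0 H0 (pi a) := st_domain st a.

Let H0sign (n : bool) h : H0 h -> H0 ((-1) ^+ n *: h).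
Proof.
case: ess => -[[H00 H0D] _ _] _ H0h.
by have := H0D ((-1) ^+ n) _ _ H0h H00; rewrite addr0.
Qed.

Let H0Jpi a : set_fun H0 H0 (Jconj J (pi a)).
Proof.
move=> h H0h; rewrite (JconjE aJ JJ); apply: H0J; apply: H0pi.
exact/H0sign/H0J.
Qed.

Let DJ h : H0 h -> D (J h) = (-1) ^+ e' *: J (D h).
Proof. by case/(trs_eps real_triple). Qed.

Let comm a b h : pi a (Jconj J (pi b) h) = Jconj J (pi b) (pi a h) :=
  trs_order_zero real_triple a b h.

Let commk' a h : pi a (k' h) = k' (pi a h) := comm a x h.

Let commutator_conformal a h :
  commutator Dk (pi a) h = k' (commutator D (pi a) (k' h)).
Proof. by rewrite /commutator (linear_sub bk'.1) /Dk /= !commk'. Qed.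

Let nuK : cancel nu (l' \o k).
Proof. by move=> h; rewrite /nu /= lK k'K. Qed.

Let nuVK : cancel (l' \o k) nu.
Proof. by move=> h; rewrite /nu /= l'K kK. Qed.

(** Since [k'] commutes with [pi a], it cancels and only conjugation by [k] remains. Stating this up
    to pointwise equality lets it be iterated for the square of [nubar]. *)
Let nubarE (f : H -> H) a : f =1 pi a -> nubar setT nu f =1 pi (y * a * x).
Proof.
move=> fE h; rewrite /nubar (pinv_setT nuK nuVK) /= fE.
by rewrite /nu /= -!commk' l'K !(srep_mul rep).
Qed.

Let bnu : bounded_op nu := bounded_op_comp (bpi y) bk'.

Lemma conformal_spectral_triple : spectral_triple star dot pi H0 Dk.
Proof.
split=> //; first exact: st_star st.
- exact: ess_selfadjoint_congruence k'K l'K symk' syml' (H0Jpi x) (H0Jpi y) ess.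
- apply: compact_resolvent_congruence bk' bl' k'K l'K syml' (H0Jpi x) (H0Jpi y)
    hn ess _.
  exact: st_compact_resolvent st.
move=> a; have [M M0 CM] := bounded_on_gt0 (st_bounded_commutator st a).
have [N N0 kN] := bounded_on_gt0 bk'.2.
exists (N * (M * N)) => h H0h; rewrite commutator_conformal.
rewrite (le_trans (kN _ I))// -mulrA ler_wpM2l ?(ltW N0)//.
by rewrite (le_trans (CM _ (H0Jpi x H0h)))// -mulrA ler_wpM2l ?(ltW M0)// kN.
Qed.

Lemma conformal_twist : twist dot pi H0 setT nu.
Proof.
split=> //.
(* [nu] is symmetric as a product of two commuting symmetric operators. *)
- apply: ess_selfadjoint_bounded bnu _ => u v.
  by rewrite /nu /= syml symk' -commk'.
- split=> [h //|u v _ _|h _]; first exact: (can_inj nuK).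
  by exists ((l' \o k) h) => //; exact: nuVK.
- by move=> a h H0h; rewrite (@nubarE _ a)//; exact: H0pi.
- move=> a; have [M aM] := (bpi (y * a * x)).2.
  by exists M => h _; rewrite (@nubarE _ a)// aM.
have [f bf fE] := inner_automorphism xy yx.
by exists f => // a h _; rewrite fE (@nubarE _ a).
Qed.

Let order_one a b T : extends H0 (commutator D (pi a)) T ->
  forall h, T (Jconj J (pi b) h) = Jconj J (pi b) (T h).
Proof.
move=> eT; apply: (trs_order_one real_triple eT).
split=> // h _; rewrite /nubar (@pinv_setT _ idfun idfun)//.
Qed.

Lemma conformal_order_one a b T N : extends H0 (commutator Dk (pi a)) T ->
  extends H0 (nubar setT nu (nubar setT nu (pi b))) N ->
  forall h, T (Jconj J N h) = Jconj J (pi b) (T h).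
Proof.
move=> [bT TE] [bN NE] h.
(* Both sides are bounded and agree on the dense set [H0]. *)
have -> : N = l \o l \o pi b \o k \o k.
  apply/funext => u; rewrite -[RHS]/(l (l (pi b (pi x (pi x u))))).
  rewrite /l -!(srep_mul rep); apply: bounded_op_dense_eq u => //.
  - by case: ess => -[_ dH _] _; exact: dH.
  - by move=> u Hu; rewrite NE// (nubarE (nubarE (frefl _))) !mulrA.
pose T0 := l' \o T \o l'.
have eT0 : extends H0 (commutator D (pi a)) T0.
  split; first exact: bounded_op_comp (bounded_op_comp bl' bT) bl'.
  move=> u; rewrite inE => Hu; rewrite /T0 /= TE ?inE; last exact: H0Jpi.
  by rewrite commutator_conformal k'K l'K.
have TT0 u : T u = k' (T0 (k' u)) by rewrite /T0 /= l'K k'K.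
have T0J c u : T0 (Jconj J (pi c) u) = Jconj J (pi c) (T0 u).
  exact: order_one eT0 u.
clearbody T0; rewrite 4!(Jconj_comp aJ JJ) -[Jconj J l]/l' -[Jconj J k]/k'.
(* With [b'] for [Jconj J (pi b)]: [k' T0 k' l' l' b' k' k' = k' T0 l' b' k' k' = T0 b' k' k' = b'
   k' T0 k'], since [T0] commutes with [l'], [b'] and [k']. *)
by rewrite TT0 !l'K (T0J y) l'K (T0J b) (T0J x) TT0.
Qed.

Let J_nu h : J (nu h) = l' (J (k' h)).
Proof. by rewrite /l' (JconjJ aJ JJ). Qed.

Let J_k' h : J (k' h) = k (J h).
Proof. exact: (J_Jconj aJ JJ h (pi_linear x)). Qed.

Lemma conformal_twisted_real_spectral_triple :
  twisted_real_spectral_triple star dot pi H0 Dk setT nu J e e'.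
Proof.
split=> //.
- exact: conformal_spectral_triple.
- exact: conformal_twist.
- exact: conformal_order_one.
- move=> h H0h; split=> //; first by apply/H0J/H0pi/H0Jpi.
  (* Up to the sign [e'], both sides reduce to [k' (J (D (k' h)))]. *)
  rewrite J_nu /Dk /= l'K DJ; last exact: H0Jpi.
  by rewrite (linear_scale bk'.1) J_k' /nu /= -(commk' x) kK.
- move=> h H0h; split; first exact: H0J.
  by rewrite J_nu /nu /= l'K J_k' kK.
Qed.

Lemma conformal_even_grading gamma e'' :
  even_grading dot pi H0 D setT idfun J gamma e'' ->
  even_grading dot pi H0 Dk setT nu J gamma e''.
Proof.
move=> g; have gl := gr_linear g.
(* [gamma] passes [J] twice, so the sign [e''] appears squared. *)
have gk' h : gamma (k' h) = k' (gamma h).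
  rewrite /k' /k !(JconjE aJ JJ) (gr_real g) (gr_commute g) (linear_scale gl).
  rewrite (gr_real g) !(linear_scale (pi_linear x)) !(antiunitary_sign aJ).
  by rewrite !scalerA mulrCA -expr2 sqrr_sign mulr1.
have gnu h : gamma (nu h) = nu (gamma h) by rewrite /nu /= (gr_commute g) gk'.
split.
- exact: gl.
- exact: gr_selfadjoint g.
- exact: gr_involutive g.
- exact: gr_commute g.
- exact: gr_domain g.
- move=> h H0h; rewrite /Dk /= gk' (gr_anticommute g); last exact: H0Jpi.
  by rewrite (linear_opp bk'.1) gk'.
- by move=> h _ _; split=> //; rewrite !gnu.
- exact: gr_real g.
Qed.

Lemma conformal_selfadjoint : selfadjoint dot H0 D -> selfadjoint dot H0 Dk.
Proof.
exact: selfadjoint_congruence k'K l'K symk' syml' (H0Jpi x) (H0Jpi y).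
Qed.

Lemma conformal_domain : set_fun H0 H0 D -> set_fun H0 H0 Dk.
Proof. by move=> H0D h H0h; apply/H0Jpi/H0D/H0Jpi. Qed.

End ConformalTwist.

Theorem proposition3p1 (R : realType) (A : algType R[i]) (star : A -> A)
    (H : completeNormedModType R[i]) (dot : {dot H for Num.conj})
    (pi : A -> H -> H) (H0 : set H) (D J : H -> H) (e e' : bool)
    (k : H -> H)
    (hreal : real_spectral_triple star dot pi H0 D J e e')
    (* k is the image of an invertible element of A *)
    (hkA : exists x y : A, [/\ x * y = 1, y * x = 1 & pi x = k])
    (hkpos : forall h : H, 0 <= dot (k h) h)
    (hkbij : bijective k)
    (hkinv : bounded_on setT (pinv setT k)) :
  let k' := Jconj J k in
  let Dk := k' \o D \o k' in
  let nu := pinv setT k \o k' in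
  [/\ twisted_real_spectral_triple star dot pi H0 Dk setT nu J e e',
      (forall (gamma : H -> H) (e'' : bool),
        even_grading dot pi H0 D setT idfun J gamma e'' ->
        even_grading dot pi H0 Dk setT nu J gamma e''),
      (* D_k is selfadjoint on H0, not just essentially so, if D is *)
      (selfadjoint dot H0 D -> selfadjoint dot H0 Dk) &
      (* D_k maps H0 to itself if D does *)
      (set_fun H0 H0 D -> set_fun H0 H0 Dk)].
Proof.
move: hkA hkpos hkbij {hkinv} => [x [y [xy yx <-]]] kpos kbij k' Dk nu.
rewrite {}/nu (pinv_rep hreal xy yx kbij).
split.
- exact: (conformal_twisted_real_spectral_triple hreal xy yx kpos kbij).
- by move=> gamma e''; exact: (conformal_even_grading hreal x y).
- exact: (conformal_selfadjoint hreal xy yx kpos kbij).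
- exact: (conformal_domain hreal x).
Qed.
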